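(* Let $n\ge1$ and let $\mathbf{L}$ be a De~Morgan lattice. The $n$-prime filters on $\mathbf{L}$ are precisely the sets $h^{-1}[G]$ for De~Morgan lattice homomorphisms $h\colon\mathbf{L}\to(\mathbf{DM}_1)^n$, where $G$ is the designated set of the direct power $(\boldsymbol{\mathcal{DM}}_1)^n$. Likewise the complete (respectively consistent, classical) $n$-prime filters on $\mathbf{L}$ are precisely the homomorphic preimages of the designated set of $(\boldsymbol{\mathcal{P}}_1)^n$ (respectively $(\boldsymbol{\mathcal{K}}_1)^n$, $(\boldsymbol{\mathcal{B}}_1)^n$).
   Context: A De~Morgan lattice is a distributive lattice with unary $\neg$ satisfying $\neg\neg x=x$ and the De~Morgan laws. $\mathbf{DM}_1$ is the four-element De~Morgan lattice on $\{\mathsf f,\mathsf n,\mathsf b,\mathsf t\}$ with $\mathsf f<\mathsf n,\mathsf b<\mathsf t$, $\mathsf n,\mathsf b$ incomparable, $\neg\mathsf t=\mathsf f$, $\neg\mathsf n=\mathsf n$, $\neg\mathsf b=\mathsf b$. $\boldsymbol{\mathcal{DM}}_1=\langle\mathbf{DM}_1,\{\mathsf t,\mathsf b\}\rangle$; $\boldsymbol{\mathcal{P}}_1$, $\boldsymbol{\mathcal{K}}_1$, $\boldsymbol{\mathcal{B}}_1$ are its substructures with universes $\{\mathsf t,\mathsf b,\mathsf f\}$, $\{\mathsf t,\mathsf n,\mathsf f\}$, $\{\mathsf t,\mathsf f\}$ and designated sets $\{\mathsf t,\mathsf b\}$, $\{\mathsf t\}$, $\{\mathsf t\}$. The direct power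 of a structure $\langle\mathbf{A},F\rangle$ is $\langle\mathbf{A}^n,\bigcap_k\pi_k^{-1}[F]\rangle$ (tuples all of whose coordinates are designated). An $n$-ideal is an $n$-filter of the order dual lattice, where an $n$-filter is an upset $F$ such that for every non-empty finite $Y$: if $\bigwedge X\in F$ for all non-empty $X\subseteq Y$ with $|X|\le n$, then $\bigwedge Y\in F$. A filter $F$ is $n$-prime if its complement is an $n$-ideal. A filter is complete if it is non-empty and $x\in F$ implies $x\wedge(y\vee\neg y)\in F$; consistent if $F\ne L$ and $(x\wedge\neg x)\vee y\in F$ implies $y\in F$; classical if both complete and consistent. *)

(* Defs.v *)
From HB Require Import structures.
From mathcomp Require Import all_boot all_order finmap.
From mathcomp Require Import boolp classical_sets.

Set Implicit Arguments.
Unset Strict Implicit.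
Unset Printing Implicit Defensive.

Import Order.TTheory.
Local Open Scope classical_set_scope.

HB.mixin Record DistrLattice_isDeMorganLattice d T of Order.DistrLattice d T := {
  dmneg : T -> T;
  dmnegK : involutive dmneg;
  dmnegI : forall x y : T, dmneg (x `&` y)%O = (dmneg x `|` dmneg y)%O;
  dmnegU : forall x y : T, dmneg (x `|` y)%O = (dmneg x `&` dmneg y)%O
}.

#[short(type="deMorganLatticeType")]
HB.structure Definition DeMorganLattice (d : Order.disp_t) :=
  { T of Order.DistrLattice d T & DistrLattice_isDeMorganLattice d T }.

Definition dm_morphism d (L : deMorganLatticeType d) d'
    (M : deMorganLatticeType d') (h : L -> M) : Prop :=
  [/\ forall x y, h (x `&` y)%O = (h x `&` h y)%O,
      forall x y, h (x `|` y)%O = (h x `|` h y)%O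
    & forall x, h (dmneg x) = dmneg (h x)].

HB.mixin Record isDMNegClosed d (L : deMorganLatticeType d) (S : {pred L}) := {
  dmneg_closed : forall x, x \in S -> dmneg x \in S
}.

#[short(type="dmClosed")]
HB.structure Definition DMClosed d (L : deMorganLatticeType d) :=
  { S of Order.isMeetLatticeClosed d L S & Order.isJoinLatticeClosed d L S
       & isDMNegClosed d L S }.

Section Subalgebra.
Variables (d : Order.disp_t) (L : deMorganLatticeType d) (S : dmClosed L).

Definition dm_sub := {x : L | x \in S}.

HB.instance Definition _ := SubChoice.on dm_sub.
HB.instance Definition _ := [SubChoice_isSubLattice of dm_sub by <: with d].

Fact dm_sub_meetUl : @left_distributive dm_sub dm_sub Order.meet Order.join.
Proof. by move=> x y z; apply: val_inj; exact: meetUl. Qed.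

HB.instance Definition _ :=
  Order.Lattice_Meet_isDistrLattice.Build d dm_sub dm_sub_meetUl.

Definition dm_sub_neg (x : dm_sub) : dm_sub :=
  exist _ (dmneg (val x)) (dmneg_closed _ (valP x)).

Fact dm_sub_negK : involutive dm_sub_neg.
Proof. by move=> x; apply: val_inj; rewrite /= dmnegK. Qed.

Fact dm_sub_negI (x y : dm_sub) :
  dm_sub_neg (x `&` y)%O = (dm_sub_neg x `|` dm_sub_neg y)%O.
Proof. by apply: val_inj; rewrite /= dmnegI. Qed.

Fact dm_sub_negU (x y : dm_sub) :
  dm_sub_neg (x `|` y)%O = (dm_sub_neg x `&` dm_sub_neg y)%O.
Proof. by apply: val_inj; rewrite /= dmnegU. Qed.

HB.instance Definition _ := DistrLattice_isDeMorganLattice.Build d dm_sub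
  dm_sub_negK dm_sub_negI dm_sub_negU.

End Subalgebra.

Section Power.
Variables (d : Order.disp_t) (L : deMorganLatticeType d) (n : nat).

Definition dm_power := n.-tupleprod[d] L.

HB.instance Definition _ := Order.DistrLattice.on dm_power.

Definition dm_power_neg (t : dm_power) : dm_power :=
  [tuple dmneg (tnth t i) | i < n].

Fact dm_power_negK : involutive dm_power_neg.
Proof. by move=> t; apply: eq_from_tnth => i; rewrite !tnth_mktuple dmnegK. Qed.

Fact dm_power_negI (s t : dm_power) :
  dm_power_neg (s `&` t)%O = (dm_power_neg s `|` dm_power_neg t)%O.
Proof. by apply: eq_from_tnth => i; rewrite !tnth_mktuple dmnegI. Qed.

Fact dm_power_negU (s t : dm_power) :
  dm_power_neg (s `|` t)%O = (dm_power_neg s `&` dm_power_neg t)%O.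
Proof. by apply: eq_from_tnth => i; rewrite !tnth_mktuple dmnegU. Qed.

HB.instance Definition _ := DistrLattice_isDeMorganLattice.Build d dm_power
  dm_power_negK dm_power_negI dm_power_negU.

End Power.

Record dmStructure := DMStructure {
  dms_disp : Order.disp_t;
  dms_alg :> deMorganLatticeType dms_disp;
  designated : set dms_alg
}.

Arguments designated : clear implicits.

Definition substructure (A : dmStructure) (S : dmClosed A) : dmStructure :=
  @DMStructure _ (dm_sub S) (val @^-1` designated A).

Definition power_structure (A : dmStructure) (n : nat) : dmStructure :=
  @DMStructure _ (dm_power A n)
    (\bigcap_(k in [set: 'I_n]) ((fun t => tnth t k) @^-1` designated A)).

Variant dm1 := DMf | DMn | DMb | DMt.

Definition dm1_code (x : dm1) : bool * bool :=
  match x with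
  | DMf => (false, false) | DMn => (false, true)
  | DMb => (true, false) | DMt => (true, true)
  end.
Definition dm1_decode (c : bool * bool) : dm1 :=
  match c with
  | (false, false) => DMf | (false, true) => DMn
  | (true, false) => DMb | (true, true) => DMt
  end.
Fact dm1_codeK : cancel dm1_code dm1_decode. Proof. by case. Qed.

HB.instance Definition _ := Countable.copy dm1 (can_type dm1_codeK).

Definition dm1_le (x y : dm1) : bool :=
  match x, y with
  | DMf, _ | _, DMt | DMn, DMn | DMb, DMb => true
  | _, _ => false
  end.
Definition dm1_meet (x y : dm1) : dm1 :=
  match x, y with
  | DMt, z | z, DMt => z
  | DMn, DMn => DMn
  | DMb, DMb => DMb
  | _, _ => DMf
  end.
Definition dm1_join (x y : dm1) : dm1 :=
  match x, y with
  | DMf, z | z, DMf => z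
  | DMn, DMn => DMn
  | DMb, DMb => DMb
  | _, _ => DMt
  end.
Definition dm1_neg (x : dm1) : dm1 :=
  match x with DMf => DMt | DMn => DMn | DMb => DMb | DMt => DMf end.

Fact dm1_leE x y : dm1_le x y = (dm1_meet x y == x).
Proof. by case: x; case: y. Qed.
Fact dm1_meetC : commutative dm1_meet. Proof. by do 2!case. Qed.
Fact dm1_joinC : commutative dm1_join. Proof. by do 2!case. Qed.
Fact dm1_meetA : associative dm1_meet. Proof. by do 3!case. Qed.
Fact dm1_joinA : associative dm1_join. Proof. by do 3!case. Qed.
Fact dm1_joinKI y x : dm1_meet x (dm1_join x y) = x.
Proof. by case: x; case: y. Qed.
Fact dm1_meetKU y x : dm1_join x (dm1_meet x y) = x.
Proof. by case: x; case: y. Qed.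
Fact dm1_meetUl : left_distributive dm1_meet dm1_join. Proof. by do 3!case. Qed.
Fact dm1_meetxx : idempotent_op dm1_meet. Proof. by case. Qed.

Fact dm1_display : Order.disp_t. Proof. exact: (Order.Disp tt tt). Qed.

HB.instance Definition _ :=
  @Order.isMeetJoinDistrLattice.Build dm1_display dm1
    dm1_le (fun x y => (y != x) && dm1_le x y) dm1_meet dm1_join
    dm1_leE (fun _ _ => erefl) dm1_meetC dm1_joinC dm1_meetA dm1_joinA
    dm1_joinKI dm1_meetKU dm1_meetUl dm1_meetxx.

Fact dm1_negK : involutive dm1_neg. Proof. by case. Qed.
Fact dm1_negI (x y : dm1) : dm1_neg (x `&` y)%O = (dm1_neg x `|` dm1_neg y)%O.
Proof. by case: x; case: y. Qed.
Fact dm1_negU (x y : dm1) : dm1_neg (x `|` y)%O = (dm1_neg x `&` dm1_neg y)%O.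
Proof. by case: x; case: y. Qed.

HB.instance Definition _ := DistrLattice_isDeMorganLattice.Build
  dm1_display dm1 dm1_negK dm1_negI dm1_negU.

Definition P1_universe : {pred dm1} := [pred x | x \in [:: DMt; DMb; DMf]].
Definition K1_universe : {pred dm1} := [pred x | x \in [:: DMt; DMn; DMf]].
Definition B1_universe : {pred dm1} := [pred x | x \in [:: DMt; DMf]].

Fact P1_meet : meet_closed P1_universe. Proof. by do 2!case. Qed.
Fact P1_join : join_closed P1_universe. Proof. by do 2!case. Qed.
Fact P1_neg (x : dm1) : x \in P1_universe -> dmneg x \in P1_universe.
Proof. by case: x. Qed.
HB.instance Definition _ :=
  Order.isMeetLatticeClosed.Build _ dm1 P1_universe P1_meet.
HB.instance Definition _ :=
  Order.isJoinLatticeClosed.Build _ dm1 P1_universe P1_join.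
HB.instance Definition _ := isDMNegClosed.Build _ dm1 P1_universe P1_neg.

Fact K1_meet : meet_closed K1_universe. Proof. by do 2!case. Qed.
Fact K1_join : join_closed K1_universe. Proof. by do 2!case. Qed.
Fact K1_neg (x : dm1) : x \in K1_universe -> dmneg x \in K1_universe.
Proof. by case: x. Qed.
HB.instance Definition _ :=
  Order.isMeetLatticeClosed.Build _ dm1 K1_universe K1_meet.
HB.instance Definition _ :=
  Order.isJoinLatticeClosed.Build _ dm1 K1_universe K1_join.
HB.instance Definition _ := isDMNegClosed.Build _ dm1 K1_universe K1_neg.

Fact B1_meet : meet_closed B1_universe. Proof. by do 2!case. Qed.
Fact B1_join : join_closed B1_universe. Proof. by do 2!case. Qed.
Fact B1_neg (x : dm1) : x \in B1_universe -> dmneg x \in B1_universe.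
Proof. by case: x. Qed.
HB.instance Definition _ :=
  Order.isMeetLatticeClosed.Build _ dm1 B1_universe B1_meet.
HB.instance Definition _ :=
  Order.isJoinLatticeClosed.Build _ dm1 B1_universe B1_join.
HB.instance Definition _ := isDMNegClosed.Build _ dm1 B1_universe B1_neg.

Definition DM1 : dmStructure := @DMStructure _ dm1 [set DMt; DMb].
Definition P1 : dmStructure := @substructure DM1 P1_universe.
Definition K1 : dmStructure := @substructure DM1 K1_universe.
Definition B1 : dmStructure := @substructure DM1 B1_universe.

Section Filters.
Variables (d : Order.disp_t) (L : latticeType d).

Definition upset (F : set L) : Prop := forall x y, F x -> (x <= y)%O -> F y.

(* The empty set is allowed as a filter. *)
Definition lattice_filter (F : set L) : Prop :=
  upset F /\ forall x y, F x -> F y -> F (x `&` y)%O.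

(* Equals the meet of X whenever x \in X; it does not depend on the choice of
   such an x, and no top element is needed. *)
Definition fset_meet (x : L) (X : {fset L}) : L :=
  (\big[Order.meet/x]_(y <- X) y)%O.

(* The witnesses y \in Y and x \in X also say that Y and X are non-empty. *)
Definition n_filter (n : nat) (F : set L) : Prop :=
  upset F /\
  forall (Y : {fset L}) (y : L), y \in Y ->
    (forall (X : {fset L}) (x : L), x \in X -> (X `<=` Y)%fset ->
       (#|` X| <= n)%N -> F (fset_meet x X)) ->
    F (fset_meet y Y).

End Filters.

Definition n_ideal d (L : latticeType d) (n : nat) (I : set L) : Prop :=
  @n_filter _ L^d n I.

Definition n_prime_filter d (L : latticeType d) (n : nat) (F : set L) : Prop :=
  lattice_filter F /\ n_ideal n (~` F).

Section DeMorganFilters.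
Variables (d : Order.disp_t) (L : deMorganLatticeType d).

Definition complete_filter (F : set L) : Prop :=
  F !=set0 /\ forall x y, F x -> F (x `&` (y `|` dmneg y))%O.

Definition consistent_filter (F : set L) : Prop :=
  F <> [set: L] /\ forall x y, F ((x `&` dmneg x) `|` y)%O -> F y.

Definition classical_filter (F : set L) : Prop :=
  complete_filter F /\ consistent_filter F.

Definition hom_preimage (A : dmStructure) (F : set L) : Prop :=
  exists2 h : L -> A, dm_morphism h & F = h @^-1` designated A.

End DeMorganFilters.

(* Main.v *)
(** A prime filter [P] (possibly empty or total) is the preimage of [{t, b}]
    under the homomorphism into DM1 recording whether [x] is in [P] and whether
    [dmneg x] is outside [P], so everything rests on writing an [n]-prime filter
    [F] as an intersection of [n] prime filters.  Let [m <= n] be least such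
    that every finite set of more than [m] elements with join in [F] has a
    proper subset with join in [F].  By minimality some [m]-element set [Y] with
    join in [F] loses this property whenever an element is removed.  The filters
    [{x | x \/ join (Y - y) in F}], for [y] in [Y], are prime and intersect to
    [F]: a failure of either would give an irredundant set of [m + 1] elements.
    If [u] outside [F] bounds [Y - y], then [x] in the filter of [y] implies
    [x \/ u] in [F], which is how consistency passes to the factors. *)

Require Import Defs.
From mathcomp Require Import all_boot all_order finmap.
From mathcomp Require Import boolp classical_sets.

Set Implicit Arguments.
Unset Strict Implicit.
Unset Printing Implicit Defensive.

Import Order.TTheory.

(** * Repeated entries and meets of finite sets *)

Lemma has_dup_rem (T : eqType) (s : seq T) :
  ~~ uniq s -> exists2 a, a \in s & a \in rem a s.
Proof.
elim: s => //= a s IHs; rewrite negb_and negbK.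
have [sa _ | nsa /= /IHs[b sb rsb]] := boolP (a \in s).
  by exists a; rewrite ?mem_head ?eqxx.
exists b; first by rewrite inE sb orbT.
by case: eqP => _ //; rewrite inE rsb orbT.
Qed.

Section FsetMeet.
Local Open Scope order_scope.
Variables (d : Order.disp_t) (L : latticeType d).

(** Used in [L^d], where [fset_meet] is a join of [L]. *)
Lemma le_fset_meet (u x : L) (X : {fset L}) :
  x \in X -> reflect {in X, forall y, u <= y} (u <= fset_meet x X).
Proof.
move=> Xx; rewrite /fset_meet.
have -> : (u <= \big[Order.meet/x]_(y <- X) y) = (u <= x) && all (>= u) X.
  elim: (enum_fset X) => [|y s IHs]; first by rewrite big_nil andbT.
  by rewrite big_cons lexI IHs /= andbCA.
apply: (iffP andP) => [[_ /allP] //|uX].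
by split; [exact: uX | exact/allP].
Qed.

End FsetMeet.

Section Covers.
Local Open Scope order_scope.
Variables (d : Order.disp_t) (L : distrLatticeType d) (F : set L).

(* For nonempty [s] this says that the join of [s] lies in [F]; the empty
   sequence covers only when [F] is everything, as if a bottom existed. *)
Definition covers (s : seq L) : Prop :=
  forall u, {in s, forall y, y <= u} -> F u.

Definition reducible_above (k : nat) : Prop :=
  forall s, covers s -> (k < size s)%N -> exists2 a, a \in s & covers (rem a s).

Definition irredundant (s : seq L) : Prop :=
  covers s /\ {in s, forall a, ~ covers (rem a s)}.

Lemma covers_le (s t : seq L) :
  {in s, forall y, exists2 z, z \in t & y <= z} -> covers s -> covers t.
Proof.
move=> st cs u tu; apply: cs => y /st[z tz yz]; exact: le_trans (tu _ tz).
Qed.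

Lemma covers_sub (s t : seq L) : {subset s <= t} -> covers s -> covers t.
Proof. by move=> st; apply: covers_le => y /st ty; exists y. Qed.

Definition prime_filter (P : set L) : Prop :=
  lattice_filter P /\ forall x y, P (x `|` y) -> P x \/ P y.

Hypothesis filtF : lattice_filter F.

Lemma covers_consI (x y : L) (s : seq L) :
  covers (x :: s) -> covers (y :: s) -> covers (x `&` y :: s).
Proof.
move=> cx cy u us.
have uxy : x `&` y <= u by apply: us; exact: mem_head.
have su : {in s, forall z, z <= u} by move=> z sz; apply: us; rewrite inE sz orbT.
(* By distributivity this meet is (x /\ y) \/ u, which equals [u]. *)
suff : F ((x `|` u) `&` (y `|` u)).
  by move=> /filtF.1; apply; rewrite -joinIl leUx uxy lexx.
apply: filtF.2; [apply: cx | apply: cy] => z; rewrite inE.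
- by case/predU1P=> [->|/su zu]; rewrite ?leUl // lexU2 // zu orbT.
- by case/predU1P=> [->|/su zu]; rewrite ?leUl // lexU2 // zu orbT.
Qed.

Lemma covers_meet (z v : L) (s : seq L) :
  covers s -> F z -> {in s, forall y, z `&` y <= v} -> F v.
Proof.
move=> cs Fz sv.
(* The join of [s] is started at [v], which stands in for a bottom. *)
have Fw : F (foldr Order.join v s).
  apply: cs; elim: s {sv} => //= y s IHs z0; rewrite inE.
  by case/predU1P=> [->|/IHs zs]; rewrite ?leUl // lexU2 // zs orbT.
apply: filtF.1 (filtF.2 _ _ Fz Fw) _.
elim: s {cs Fw} sv => /= [|y s IHs] sv; first by rewrite leIr.
rewrite meetUr leUx sv ?mem_head //; apply: IHs => a sa.
by apply: sv; rewrite inE sa orbT.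
Qed.

(** * Prime filters attached to an irredundant cover of maximal size *)

Section MaximalIrredundant.
Variable Y : seq L.
Hypotheses (redF : reducible_above (size Y)) (irrY : irredundant Y).

Definition cofactor (y : L) : set L := [set x | covers (x :: rem y Y)]%classic.

Lemma cofactor_prime (y : L) : y \in Y -> prime_filter (cofactor y).
Proof.
move=> Yy; have [cY nY] := irrY.
have pY := perm_to_rem Yy.
split; first split.
- move=> a b /= ca ab; apply: covers_le ca => c; rewrite inE.
  case/predU1P=> [->|sc]; first by exists b; rewrite ?mem_head.
  by exists c; rewrite ?inE ?sc ?orbT.
- by move=> a b; exact: covers_consI.
move=> x x' cxx'.
have cy : covers (y :: rem y Y) by apply: covers_sub cY => a; rewrite (perm_mem pY).
have c2 : covers [:: x `&` y, x' `&` y & rem y Y].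
  move=> u su; apply: (covers_consI cxx' cy) => a; rewrite inE.
  case/predU1P=> [->|sa]; last by apply: su; rewrite !inE sa !orbT.
  by rewrite meetUl leUx !su // !inE eqxx ?orbT.
have [|a] := redF c2; first by rewrite /= (perm_size pY) /= ltnS.
have shrink v : covers (v `&` y :: rem y Y) -> covers (v :: rem y Y).
  apply: covers_le => c; rewrite inE.
  case/predU1P=> [->|sc]; first by exists v; rewrite ?mem_head ?leIl.
  by exists c; rewrite ?inE ?sc ?orbT.
rewrite !inE /=; case: (eqVneq (x `&` y) a) => [_ _ /shrink|_]; first by right.
case: (eqVneq (x' `&` y) a) => [_ _ /shrink|_ ra cra]; first by left.
have {}ra : a \in rem y Y by case/or3P: ra => // /eqP.
have Ya := mem_rem ra.
have pa : perm_eq (rem a Y) (y :: rem a (rem y Y)).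
  rewrite -(perm_cons a) -(permPl (perm_to_rem Ya)) (permPl pY).
  by rewrite perm_sym (perm_catCA [:: a] [:: y]) /= perm_cons perm_sym perm_to_rem.
case: (nY a Ya); apply: covers_le cra => c; rewrite 2!inE.
have ya : y \in rem a Y by rewrite (perm_mem pa) mem_head.
case/or3P=> [/eqP->|/eqP->|rc]; try by exists y; rewrite ?leIr.
by exists c; rewrite // (perm_mem pa) inE rc orbT.
Qed.

Lemma sub_cofactor (x y : L) : F x -> cofactor y x.
Proof. by move=> Fx u xu; apply: filtF.1 Fx _; apply: xu; exact: mem_head. Qed.

Lemma irredundant_bound (y : L) : y \in Y ->
  exists2 u, ~ F u & {in rem y Y, forall z, z <= u}.
Proof.
move=> Yy; apply: contrapT => nu; apply: (irrY.2 y Yy) => u uY.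
by apply: contrapT => nFu; apply: nu; exists u.
Qed.

Lemma cofactor_join (x y u : L) :
  {in rem y Y, forall z, z <= u} -> cofactor y x -> F (x `|` u).
Proof.
move=> Yu; apply=> z; rewrite inE.
by case/predU1P=> [->|/Yu zu]; rewrite ?leUl // lexU2 // zu orbT.
Qed.

(* With [b] below bounds [u y] of the sets [rem y Y], the elements [b] and
   [x `&` y], [y \in Y], cover and are one too many.  Dropping [x `&` y] would
   put [u y] in [F]; dropping [b] leaves elements below [x]. *)
Lemma cofactor_cap (x : L) :
  Y != [::] -> {in Y, forall y, cofactor y x} -> F x.
Proof.
move=> Y0 Yx; have [cY _] := irrY.
have /choice[u uP] (y : L) :
    exists u, y \in Y -> ~ F u /\ {in rem y Y, forall z, z <= u}.
  have [/irredundant_bound[u]|] := boolP (y \in Y); first by exists u.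
  by exists y.
have Fxu : {in Y, forall y, F (x `|` u y)}.
  by move=> y Yy; apply: cofactor_join (uP y Yy).2 (Yx y Yy).
(* [b] is the meet of the [u y], started at [u y0] in place of a top; joining with [x] distributes
   over it. *)
have [b bu Fxb] : exists2 b, {in Y, forall y, b <= u y} & F (x `|` b).
  have [y0 Yy0] : exists y0, y0 \in Y.
    by case: (Y) Y0 => // y0 s _; exists y0; exact: mem_head.
  have : {subset Y <= Y} by [].
  elim: {1 3}Y => [|y s IHs] sY; first by exists (u y0); last exact: Fxu.
  have [z sz|b bs Fb] := IHs; first by apply: sY; rewrite inE sz orbT.
  exists (u y `&` b) => [z|].
    by rewrite inE => /predU1P[->|/bs bz]; rewrite ?leIl // leIx2 // bz orbT.
  by rewrite joinIr; apply: filtF.2 Fb; apply/Fxu/sY/mem_head.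
pose f y := x `&` y.
have cb : covers (b :: map f Y).
  (* (x \/ b) /\ y is the join of x /\ y and b /\ y, both below [v]. *)
  move=> v bv; apply: (covers_meet cY Fxb) => y Yy.
  rewrite meetUl leUx bv ?inE ?map_f ?orbT //=.
  by apply: le_trans (leIl _ _) (bv _ (mem_head _ _)).
have [|a] := redF cb; first by rewrite /= size_map.
rewrite inE /= eq_sym; have [_ _ cf|_ /= /mapP[y Yy ->]] := eqVneq b a.
  by apply: cf => _ /mapP[y _ ->]; exact: leIl.
move=> cr; case: (uP y Yy) => nFu yu; case: nFu; apply: cr => c.
have pf : perm_eq (rem (f y) (map f Y)) (map f (rem y Y)).
  rewrite -(perm_cons (f y)) -(permPl (perm_to_rem (map_f f Yy))).
  by rewrite -map_cons perm_map ?perm_to_rem.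
rewrite inE (perm_mem pf) => /predU1P[->|/mapP[z rz ->]]; first exact: bu.
by apply: le_trans (leIr _ _) (yu _ rz).
Qed.

End MaximalIrredundant.

(** * Decomposition into prime filters, and its link with n-ideals *)

Lemma reducible_above0 (s : seq L) :
  reducible_above 0 -> covers s -> forall x, F x.
Proof.
(* Entries are dropped until the empty sequence covers, which forces [F] to be everything. *)
move=> red0; elim: {s}(size s) {-2}s (erefl (size s)) => [|k IHk] s sk cs x.
  by apply: cs => y; rewrite (size0nil sk).
have [|a sa] := red0 _ cs; first by rewrite sk.
by move=> cr; apply: IHk cr x; rewrite size_rem // sk.
Qed.

Lemma prime_decomposition (n : nat) :
  (0 < n)%N -> reducible_above n -> ~ (forall x, F x) ->
  exists P : 'I_n -> set L,
    [/\ forall i, prime_filter (P i),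
        forall i, exists2 u, ~ F u & forall x, P i x -> F (x `|` u)
      & forall x, F x <-> forall i, P i x].
Proof.
move=> n_gt0 redn nFT.
have exred : exists k, `[< reducible_above k >] by exists n; exact/asboolP.
case: (ex_minnP exred) => [[|m] /asboolP redm min_m].
  (* Least bound 0: [F] is empty, because [[:: x]] covers for every [x] in [F]. The empty set is a
     prime filter, and [0 < n] makes the intersection of [n] copies of it empty. *)
  have F0 x : ~ F x.
    move=> Fx; apply: nFT; apply: (@reducible_above0 [:: x]) => // u xu.
    by apply: filtF.1 Fx _; apply: xu; exact: mem_head.
  exists (fun=> set0); split=> [i|i|x]; first by split=> //; split=> x y [].
    by have /existsNP[u nFu] := nFT; exists u.
  by split=> [/F0//|/(_ (Ordinal n_gt0))].
(* By minimality [reducible_above m] fails; a sequence witnessing this is irredundant, and [redm]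
   keeps its size from exceeding [m.+1]. *)
have [Y irrY sY] : exists2 Y, irredundant Y & size Y = m.+1.
  apply: contrapT => nY.
  have : `[< reducible_above m >]; last by move/min_m; rewrite ltnn.
  apply/asboolP => s cs lt_ms; apply: contrapT => nrs; apply: nY.
  have nrs' : {in s, forall a, ~ covers (rem a s)}.
    by move=> a sa ca; apply: nrs; exists a.
  exists s; first by split.
  apply/eqP; rewrite eqn_leq lt_ms andbT leqNgt.
  by apply/negP=> /(redm _ cs)[a /nrs'].
have le_mn : (m < n)%N by apply: min_m; exact/asboolP.
rewrite -sY in redm.
have [y0 Yy0] : exists y0, y0 \in Y.
  by case: (Y) sY => // y0 s _; exists y0; exact: mem_head.
(* Indices from [size Y] on fall back to [y0], so the [m.+1] cofactors fill a family over ['I_n]. *)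
have Y_ i : nth y0 Y i \in Y.
  by have [/(mem_nth y0)//|/(nth_default y0)->] := ltnP i (size Y).
exists (fun i => cofactor Y (nth y0 Y i)); split=> [i|i|x].
- exact: cofactor_prime.
- have [u nFu uY] := irredundant_bound irrY (Y_ i); exists u => // x.
  exact: cofactor_join.
split=> [Fx i|Yx]; first exact: sub_cofactor.
apply: (cofactor_cap redm irrY) => [|y Yy]; first by rewrite -size_eq0 sY.
have lt_y : (index y Y < n)%N by rewrite (leq_trans _ le_mn) // -sY index_mem.
by have := Yx (Ordinal lt_y); rewrite /= nth_index.
Qed.

Lemma n_ideal_reducible (n : nat) : n_ideal n (~` F)%classic -> reducible_above n.
Proof.
case=> _ idF s cs lt_ns.
have [us|/has_dup_rem[a sa rsa]] := boolP (uniq s); last first.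
  exists a => //; apply: covers_sub cs => b; rewrite (perm_mem (perm_to_rem sa)).
  by case/predU1P=> [->|].
have [y sy] : exists y, y \in s.
  by case: (s) lt_ns => // y s' _; exists y; rewrite mem_head.
pose Y : {fset L^d} := seq_fset tt s.
have YE : Y =i s by exact: seq_fsetE.
apply: contrapT => nred.
have Yy : (y : L^d) \in Y by rewrite YE.
case: (idF Y y Yy) => [X x Xx XY Xn FX|]; last first.
  by apply: cs => z sz; apply: (le_fset_meet _ Yy (lexx _)); rewrite YE.
apply: nred.
have [a sa nXa] : exists2 a, a \in s & (a : L^d) \notin X.
  apply: contrapT => nex; have : (size s <= size (enum_fset X))%N.
    apply: uniq_leq_size => // a sa; apply: contrapT => /negP nXa.
    by apply: nex; exists a.
  by rewrite leqNgt (leq_ltn_trans Xn lt_ns).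
exists a => // u au; apply: filtF.1 FX _.
apply/(@le_fset_meet _ L^d u _ _ Xx) => z Xz; apply: au.
rewrite mem_rem_uniq // inE -(YE z) (fsubsetP XY) // andbT.
by apply: contraNneq nXa => <-.
Qed.

(** A prime filter [P i] containing the join of [Y] contains some [f i] in [Y]. These at most [n]
    elements have their join in every [P i], hence in [F]. *)
Lemma cap_prime_n_ideal (n : nat) (P : 'I_n -> set L) :
  (0 < n)%N -> (forall i, prime_filter (P i)) ->
  (forall x, F x <-> forall i, P i x) -> n_ideal n (~` F)%classic.
Proof.
move=> n_gt0 primeP FE; split=> [x y nFx yx Fy|Y y Yy nF FY].
  by apply: nFx; apply: filtF.1 Fy yx.
have Pex i : exists2 y, y \in Y & P i y.
  apply: contrapT => nex.
  have : P i (fset_meet y Y) by exact: (FE _).1.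
  have nP : {in enum_fset Y, forall z, ~ P i z}.
    by move=> z Yz Pz; apply: nex; exists z.
  have nPy := nP y Yy; rewrite /fset_meet.
  elim: (enum_fset Y) nP => [|z s IHs] nP; first by rewrite big_nil.
  rewrite big_cons => /(primeP i).2[]; first by apply: nP; exact: mem_head.
  by apply: IHs => a sa; apply: nP; rewrite inE sa orbT.
have /choice[f fP] i : exists y, y \in Y /\ P i y.
  by have [z] := Pex i; exists z.
pose X : {fset L^d} := [fset f i | i : 'I_n]%fset.
have Xf i : f i \in X by apply/imfsetP; exists i.
apply: (nF X (f (Ordinal n_gt0)) (Xf _)).
- by apply/fsubsetP=> _ /imfsetP[i _ ->]; exact: (fP i).1.
- by rewrite (leq_trans (leq_imfset_card _ _ _)) //= -cardE card_ord.
- apply/FE => i; apply: (primeP i).1.1 (fP i).2 _.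
  exact: (@le_fset_meet _ L^d _ _ _ (Xf _) (lexx _)).
Qed.

End Covers.

(** * Homomorphisms into [DM1] and its powers *)

Section Homomorphisms.
Local Open Scope classical_set_scope.
Local Open Scope order_scope.
Variables (d : Order.disp_t) (L : deMorganLatticeType d).
Implicit Types (F P : set L) (n : nat).

Lemma designated_DM1E (x : dm1) : designated DM1 x <-> (dm1_code x).1.
Proof. by case: x; split=> //; (by case) || (by left) || (by right). Qed.

Lemma designated_DM1I (x y : dm1) :
  designated DM1 (x `&` y) <-> designated DM1 x /\ designated DM1 y.
Proof. by rewrite !designated_DM1E; case: x; case: y; split=> // -[]. Qed.

Lemma designated_DM1U (x y : dm1) :
  designated DM1 (x `|` y) <-> designated DM1 x \/ designated DM1 y.
Proof.
by rewrite !designated_DM1E; case: x; case: y; split=> //; (by left) || (by right) || case.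
Qed.

Lemma dm_morphism_prime (h : L -> dm1) :
  dm_morphism h -> prime_filter (h @^-1` designated DM1).
Proof.
case=> hI hU _; split; first split.
- move=> x y /= hx /meet_idPl xy; move: hx; rewrite -xy hI.
  by case/designated_DM1I.
- by move=> x y hx hy /=; rewrite hI; apply/designated_DM1I.
- by move=> x y /=; rewrite hU => /designated_DM1U.
Qed.

(** The second bit of [dm1_code] is set exactly at [DMt] and [DMn], whose negations are
    undesignated, so a homomorphism with preimage [P] must take this value. *)
Definition prime_hom P (x : L) : dm1 :=
  dm1_decode (`[< P x >], ~~ `[< P (dmneg x) >]).

Lemma prime_filterI P x y :
  prime_filter P -> `[< P (x `&` y) >] = `[< P x >] && `[< P y >].
Proof.
case=> [[upP PI] _]; apply/asboolP/andP => [Pxy|[/asboolP Px /asboolP Py]].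
  by split; apply/asboolP; apply: upP Pxy _; rewrite ?leIl ?leIr.
exact: PI.
Qed.

Lemma prime_filterU P x y :
  prime_filter P -> `[< P (x `|` y) >] = `[< P x >] || `[< P y >].
Proof.
case=> [[upP _] PU]; apply/asboolP/orP => [/PU[]/asboolP|]; [by left|by right|].
by case=> /asboolP Pz; apply: upP Pz _; rewrite ?leUl ?leUr.
Qed.

Lemma prime_hom_morphism P : prime_filter P -> dm_morphism (prime_hom P).
Proof.
move=> primeP; split=> [x y|x y|x]; rewrite /prime_hom.
- rewrite dmnegI prime_filterI // prime_filterU // negb_or.
  by do 4!case: `[< _ >].
- rewrite dmnegU prime_filterI // prime_filterU // negb_and.
  by do 4!case: `[< _ >].
- by rewrite dmnegK; do 2!case: `[< _ >].
Qed.

Lemma prime_hom_designated P x : designated DM1 (prime_hom P x) <-> P x.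
Proof.
rewrite designated_DM1E /prime_hom.
by case: asboolP => Px; case: `[< _ >]; split.
Qed.

Lemma hom_preimage_powerP (A : dmStructure) n F :
  hom_preimage (power_structure A n) F <->
  exists2 h : 'I_n -> L -> A, forall i, dm_morphism (h i)
    & forall x, F x <-> forall i, designated A (h i x).
Proof.
split=> [[h [hI hU hN] ->]|[h homh FE]].
  exists (fun i x => tnth (h x) i) => [i|x].
    by split=> [x y|x y|x]; rewrite (hI, hU, hN) !tnth_mktuple.
  by split=> [Fx i|Fx i _]; [exact: Fx | exact: Fx].
exists (fun x => [tuple h i x | i < n]).
  split=> [x y|x y|x]; apply: eq_from_tnth => i; rewrite !tnth_mktuple;
    by case: (homh i).
apply/seteqP; split=> x /=; first by move=> /FE Fx i _ /=; rewrite tnth_mktuple.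
by move=> Fx; apply/FE => i; have := Fx i I; rewrite /= tnth_mktuple.
Qed.

(** Trades the substructure for a condition on values, so that homomorphisms into [DM1] serve for
    [P1], [K1] and [B1]. *)
Lemma hom_preimage_power_subP (A : dmStructure) (S : dmClosed A) n F :
  hom_preimage (power_structure (substructure S) n) F <->
  exists h : 'I_n -> L -> A,
    [/\ forall i, dm_morphism (h i), forall i x, h i x \in S
      & forall x, F x <-> forall i, designated A (h i x)].
Proof.
rewrite hom_preimage_powerP; split=> [[h homh FE]|[h [homh hS FE]]].
  exists (fun i x => val (h i x)); split=> // [i|i x]; last exact: valP.
  by have [hI hU hN] := homh i; split=> [x y|x y|x]; rewrite (hI, hU, hN).
exists (fun i x => exist _ (h i x) (hS i x) : dm_sub S) => // i.
by have [hI hU hN] := homh i; split=> [x y|x y|x]; apply: val_inj => /=.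
Qed.

Lemma n_prime_filter_DM1 n F : (0 < n)%N -> n_prime_filter n F ->
  exists h : 'I_n -> L -> dm1,
    [/\ forall i, dm_morphism (h i),
        forall x, F x <-> forall i, designated DM1 (h i x),
        complete_filter F -> forall i x, h i x != DMn
      & consistent_filter F -> forall i x, h i x != DMb].
Proof.
move=> n_gt0 [filtF /(n_ideal_reducible filtF) redF].
have [FT|nFT] := pselect (forall x, F x).
  (* The total filter comes from the constant map to [DMb]; it is not consistent. *)
  exists (fun=> prime_hom setT); split=> [i|x|_ i x|[nF _]].
  - by apply: prime_hom_morphism; split=> //; left.
  - by split=> // _ i; apply/prime_hom_designated.
  - by rewrite /prime_hom !asboolT.
  - by case: nF; apply/seteqP; split.
have [P [primeP boundP FE]] := prime_decomposition filtF n_gt0 redF nFT.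
exists (fun i => prime_hom (P i)); split=> [i|x|[[z Fz] Fc] i x|[_ Fc] i x].
- exact: prime_hom_morphism.
- rewrite FE; split=> Px i; [exact/prime_hom_designated|].
  by apply/prime_hom_designated; exact: Px.
(* Completeness puts [x] or its negation into [P i], whereas [DMn] means that neither is there. *)
- have : P i (z `&` (x `|` dmneg x)) by apply: (FE _).1; exact: Fc.
  move=> /asboolP; rewrite prime_filterI // prime_filterU // => /andP[_].
  by rewrite /prime_hom; do 2!case: `[< _ >].
(* [DMb] means that [x] and its negation, hence their meet, lie in [P i]. The join of this meet with
   [u] is then in [F], and consistency gives [u] in [F]. *)
- apply/negP => /eqP hx; have [u nFu Pu] := boundP i; apply: nFu.
  apply: (Fc x); apply: Pu; apply/asboolP; move: hx; rewrite prime_filterI //.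
  by rewrite /prime_hom; do 2!case: `[< _ >].
Qed.

Section Preimage.
Variables (n : nat) (F : set L) (h : 'I_n -> L -> dm1).
Hypotheses (homh : forall i, dm_morphism (h i))
  (FE : forall x, F x <-> forall i, designated DM1 (h i x)).

Lemma DM1_preimage_n_prime : (0 < n)%N -> n_prime_filter n F.
Proof.
move=> n_gt0; pose P i := h i @^-1` designated DM1.
have primeP i : prime_filter (P i) by exact: dm_morphism_prime.
have filtF : lattice_filter F.
  split=> [x y /FE Fx xy|x y /FE Fx /FE Fy]; apply/FE => i.
    exact: (primeP i).1.1 (Fx i) xy.
  exact: (primeP i).1.2 (Fx i) (Fy i).
by split=> //; exact: (cap_prime_n_ideal filtF n_gt0 primeP).
Qed.

(** Away from [DMn], the join of an element with its negation is [DMt] or [DMb]. *)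
Lemma DM1_preimage_complete :
  inhabited L -> (forall i x, h i x != DMn) -> complete_filter F.
Proof.
move=> [z] hn; have top x i : designated DM1 (h i (x `|` dmneg x)).
  have [_ hU hN] := homh i; rewrite hU hN.
  by case: (h i x) (hn i x) => // _; [left | right | left].
split=> [|x y /FE Fx]; first by exists (z `|` dmneg z); apply/FE.
apply/FE => i; have [hI _ _] := homh i; rewrite hI.
by apply/designated_DM1I; split.
Qed.

(** Away from [DMb], the meet of an element with its negation is [DMf] or [DMn]; [0 < n] supplies a
    coordinate showing that [F] is proper. *)
Lemma DM1_preimage_consistent :
  inhabited L -> (0 < n)%N -> (forall i x, h i x != DMb) -> consistent_filter F.
Proof.
move=> [z] n_gt0 hb; have bot x i : ~ designated DM1 (h i (x `&` dmneg x)).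
  have [hI _ hN] := homh i; rewrite hI hN.
  by case: (h i x) (hb i x) => // _ [].
split=> [FT|x y /FE Fx].
  have : F (z `&` dmneg z) by rewrite FT.
  by move=> /FE /(_ (Ordinal n_gt0)) /bot.
apply/FE => i; have := Fx i; have [_ hU _] := homh i; rewrite hU.
by case/designated_DM1U => // /bot.
Qed.

End Preimage.
End Homomorphisms.

Theorem mainTheorem4 (n : nat) (hn : (1 <= n)%N) (d : Order.disp_t)
    (L : deMorganLatticeType d) (hL : inhabited L) :
  [/\ forall F : set L,
        n_prime_filter n F <-> hom_preimage (power_structure DM1 n) F,
      forall F : set L,
        n_prime_filter n F /\ complete_filter F <->
        hom_preimage (power_structure P1 n) F,
      forall F : set L,
        n_prime_filter n F /\ consistent_filter F <->
        hom_preimage (power_structure K1 n) F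
    & forall F : set L,
        n_prime_filter n F /\ classical_filter F <->
        hom_preimage (power_structure B1 n) F].
Proof.
(* Each universe is described by its excluded values, the form in which completeness and consistency
   act. *)
have inP1 (x : dm1) : (x \in P1_universe) = (x != DMn) by case: x.
have inK1 (x : dm1) : (x \in K1_universe) = (x != DMb) by case: x.
have inB1 (x : dm1) : (x \in B1_universe) = (x != DMn) && (x != DMb) by case: x.
split=> F.
- rewrite hom_preimage_powerP; split=> [primeF|[h homh FE]].
    by have [h [homh FE _ _]] := n_prime_filter_DM1 hn primeF; exists h.
  exact: DM1_preimage_n_prime homh FE hn.
- rewrite hom_preimage_power_subP; split=> [[primeF cF]|[h [homh hS FE]]].
    have [h [homh FE hP _]] := n_prime_filter_DM1 hn primeF; exists h.
    by split=> // i x; rewrite inP1 hP.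
  split; first exact: DM1_preimage_n_prime homh FE hn.
  by apply: DM1_preimage_complete homh FE hL _ => i x; rewrite -inP1.
- rewrite hom_preimage_power_subP; split=> [[primeF cF]|[h [homh hS FE]]].
    have [h [homh FE _ hK]] := n_prime_filter_DM1 hn primeF; exists h.
    by split=> // i x; rewrite inK1 hK.
  split; first exact: DM1_preimage_n_prime homh FE hn.
  by apply: DM1_preimage_consistent homh FE hL hn _ => i x; rewrite -inK1.
- rewrite hom_preimage_power_subP.
  split=> [[primeF [cF kF]]|[h [homh hS FE]]].
    have [h [homh FE hP hK]] := n_prime_filter_DM1 hn primeF; exists h.
    by split=> // i x; rewrite inB1 hP ?hK.
  have hB i x : (h i x != DMn) && (h i x != DMb) by rewrite -inB1.
  split; first exact: DM1_preimage_n_prime homh FE hn.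
  split.
    by apply: DM1_preimage_complete homh FE hL _ => i x; case/andP: (hB i x).
  by apply: DM1_preimage_consistent homh FE hL hn _ => i x; case/andP: (hB i x).
Qed.
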